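(* The set of indices of computable lattices that are algebraic is $\Pi^1_1$-hard.
   Context: A computable lattice $(L,\preceq)$ has underlying set $L=\omega$ and a computable lattice ordering $\preceq$, formally a computable subset of $\omega^2$. An index of a computable lattice is a number $e$ such that the partial computable function $\varphi_e$ is (total and is) the characteristic function of a lattice ordering $\preceq\subseteq\omega^2$ on $\omega$. A lattice is complete if every subset has both a supremum and an infimum. An element $a\in L$ is compact if for each subset $S\subseteq L$, if $a\preceq\sup S$ then there is a finite subset $S'\subseteq S$ such that $a\preceq\sup S'$. A lattice is compactly generated if every element is the supremum of a set of compact elements, and algebraic if it is complete and compactly generated. A set $C\subseteq\omega$ is $\Pi^1_1$ if it has the form $\{n\in\omega\mid \forall f\in\omega^\omega\ \varphi_e^f(n)\downarrow\}$ for some $e$. A set $A\subseteq\omega$ is $\Pi^1_1$-hard if for each $\Pi^1_1$ set $C$ there is a computable function $f$ such that for all $n$, $n\in C$ iff $f(n)\in A$. *)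

(* Defs.v *)
From Stdlib Require Import Arith Lia Cantor.
From Stdlib Require Import Relation_Definitions Ensembles Finite_sets.

Definition upper_bound {L : Type} (le : relation L) (S : Ensemble L) (u : L)
  : Prop := forall x, In L S x -> le x u.

Definition lower_bound {L : Type} (le : relation L) (S : Ensemble L) (l : L)
  : Prop := forall x, In L S x -> le l x.

Definition is_sup {L : Type} (le : relation L) (S : Ensemble L) (s : L)
  : Prop := upper_bound le S s /\ forall u, upper_bound le S u -> le s u.

Definition is_inf {L : Type} (le : relation L) (S : Ensemble L) (i : L)
  : Prop := lower_bound le S i /\ forall l, lower_bound le S l -> le l i.

Definition lattice_order {L : Type} (le : relation L) : Prop :=
  order L le /\
  forall x y, (exists s, is_sup le (Couple L x y) s) /\
              (exists i, is_inf le (Couple L x y) i).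

Definition complete {L : Type} (le : relation L) : Prop :=
  forall S : Ensemble L, (exists s, is_sup le S s) /\ (exists i, is_inf le S i).

(** [a] is below [sup S], the existence of [sup S] being part of the claim. *)
Definition below_sup {L : Type} (le : relation L) (a : L) (S : Ensemble L)
  : Prop := exists s, is_sup le S s /\ le a s.

Definition compact {L : Type} (le : relation L) (a : L) : Prop :=
  forall S : Ensemble L, below_sup le a S ->
  exists S' : Ensemble L,
    Finite L S' /\ Included L S' S /\ below_sup le a S'.

Definition compactly_generated {L : Type} (le : relation L) : Prop :=
  forall x, exists S : Ensemble L, Included L S (compact le) /\ is_sup le S x.

Definition algebraic {L : Type} (le : relation L) : Prop :=
  complete le /\ compactly_generated le.

(** Partial recursive functions relative to an oracle.  All functions are
    unary; several arguments are passed through the Cantor pairing function, a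
    bijection from [nat * nat] to [nat]. *)

Definition npair (x y : nat) : nat := Cantor.to_nat (x, y).
Definition nfst (z : nat) : nat := fst (Cantor.of_nat z).
Definition nsnd (z : nat) : nat := snd (Cantor.of_nat z).

Inductive code : Type :=
| Zero | Succ | Fst | Snd | Oracle
| Pair (a b : code)
| Comp (a b : code)
| Prec (a b : code)
| Mu (a : code).

(** [eval f c x y]: the program [c] with oracle [f] halts on input [x] with
    output [y].  [Prec a b] maps [npair p n] to [h p n], where [h p 0 = a p] and
    [h p (k + 1) = b (npair p (npair k (h p k)))]; [Mu a] maps [x] to the least
    [y] with [a (npair x y) = 0], provided [a (npair x i)] is defined for all
    [i < y]. *)
Fixpoint eval (f : nat -> nat) (c : code) (x y : nat) {struct c} : Prop :=
  match c with
  | Zero => y = 0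
  | Succ => y = S x
  | Fst => y = nfst x
  | Snd => y = nsnd x
  | Oracle => y = f x
  | Pair a b => exists u v, eval f a x u /\ eval f b x v /\ y = npair u v
  | Comp a b => exists u, eval f b x u /\ eval f a u y
  | Prec a b =>
      nat_rect (fun _ => nat -> Prop)
        (fun z => eval f a (nfst x) z)
        (fun k R z => exists r, R r /\ eval f b (npair (nfst x) (npair k r)) z)
        (nsnd x) y
  | Mu a =>
      eval f a (npair x y) 0 /\
      forall i, i < y -> exists v, eval f a (npair x i) (S v)
  end.

Lemma eval_functional (f : nat -> nat) (c : code) (x y z : nat) :
  eval f c x y -> eval f c x z -> y = z.
Proof.
revert x y z; induction c as [| | | | |a IHa b IHb|a IHa b IHb|a IHa b IHb|a IHa];
  intros x y z; cbn [eval]; try congruence.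
- intros (u & v & Hu & Hv & ->) (u' & v' & Hu' & Hv' & ->).
  now rewrite (IHa _ _ _ Hu Hu'), (IHb _ _ _ Hv Hv').
- intros (u & Hu & Hy) (u' & Hu' & Hz).
  rewrite (IHb _ _ _ Hu Hu') in Hy; exact (IHa _ _ _ Hy Hz).
- revert y z; induction (nsnd x) as [|k IH]; cbn [nat_rect]; intros y z.
  + apply IHa.
  + intros (r & Hr & Hy) (r' & Hr' & Hz).
    rewrite (IH _ _ Hr Hr') in Hy; exact (IHb _ _ _ Hy Hz).
- intros [Hy Ly] [Hz Lz].
  destruct (Nat.lt_total y z) as [H|[H|H]]; [|exact H|].
  + destruct (Lz y H) as [v Hv]; discriminate (IHa _ _ _ Hy Hv).
  + destruct (Ly z H) as [v Hv]; discriminate (IHa _ _ _ Hz Hv).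
Qed.

(** A Goedel numbering of programs, bijective by [decode_encode] and
    [encode_decode] below. *)
Fixpoint encode (c : code) : nat :=
  match c with
  | Zero => 0
  | Succ => 1
  | Fst => 2
  | Snd => 3
  | Oracle => 4
  | Pair a b => 5 + 4 * npair (encode a) (encode b)
  | Comp a b => 6 + 4 * npair (encode a) (encode b)
  | Prec a b => 7 + 4 * npair (encode a) (encode b)
  | Mu a => 8 + 4 * encode a
  end.

(** The recursive calls of the decoding are on smaller numbers, so that fuel
    greater than [e] suffices to decode [e]. *)
Fixpoint decode_fuel (k e : nat) {struct k} : code :=
  match k with
  | 0 => Zero
  | S k =>
      match e with
      | 0 => Zero
      | 1 => Succ
      | 2 => Fst
      | 3 => Snd
      | 4 => Oracle
      | S (S (S (S (S m)))) =>
          let q := m / 4 in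
          match m mod 4 with
          | 0 => Pair (decode_fuel k (nfst q)) (decode_fuel k (nsnd q))
          | 1 => Comp (decode_fuel k (nfst q)) (decode_fuel k (nsnd q))
          | 2 => Prec (decode_fuel k (nfst q)) (decode_fuel k (nsnd q))
          | _ => Mu (decode_fuel k q)
          end
      end
  end.

Definition decode (e : nat) : code := decode_fuel (S e) e.

Lemma nfst_npair (x y : nat) : nfst (npair x y) = x.
Proof. unfold nfst, npair; now rewrite Cantor.cancel_of_to. Qed.

Lemma nsnd_npair (x y : nat) : nsnd (npair x y) = y.
Proof. unfold nsnd, npair; now rewrite Cantor.cancel_of_to. Qed.

Lemma npair_nfst_nsnd (z : nat) : npair (nfst z) (nsnd z) = z.
Proof.
unfold nfst, nsnd, npair.
now rewrite <- surjective_pairing, Cantor.cancel_to_of.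
Qed.

Lemma npair_bound (x y : nat) : x <= npair x y /\ y <= npair x y.
Proof.
assert (H := Cantor.to_nat_non_decreasing x y); unfold npair; lia.
Qed.

Lemma div_mod_4 (q r : nat) :
  r < 4 -> (r + 4 * q) / 4 = q /\ (r + 4 * q) mod 4 = r.
Proof.
intros Hr; split.
- symmetry; apply (Nat.div_unique _ 4 q r); lia.
- symmetry; apply (Nat.mod_unique _ 4 q r); lia.
Qed.

Lemma decode_fuel_encode (c : code) (k : nat) :
  encode c < k -> decode_fuel k (encode c) = c.
Proof.
revert k; induction c as [| | | | |a IHa b IHb|a IHa b IHb|a IHa b IHb|a IHa];
  intros [|k] Hk; try reflexivity; try (exfalso; lia).
- cbn [encode] in *.
  destruct (npair_bound (encode a) (encode b)) as [Ba Bb].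
  destruct (div_mod_4 (npair (encode a) (encode b)) 0) as [Hq Hr]; [lia|].
  change (5 + 4 * npair (encode a) (encode b))
    with (5 + (0 + 4 * npair (encode a) (encode b))).
  cbn [decode_fuel Nat.add] in *; rewrite Hr, Hq, nfst_npair, nsnd_npair.
  rewrite IHa, IHb by lia; reflexivity.
- cbn [encode] in *.
  destruct (npair_bound (encode a) (encode b)) as [Ba Bb].
  destruct (div_mod_4 (npair (encode a) (encode b)) 1) as [Hq Hr]; [lia|].
  cbn [decode_fuel Nat.add] in *; rewrite Hr, Hq, nfst_npair, nsnd_npair.
  rewrite IHa, IHb by lia; reflexivity.
- cbn [encode] in *.
  destruct (npair_bound (encode a) (encode b)) as [Ba Bb].
  destruct (div_mod_4 (npair (encode a) (encode b)) 2) as [Hq Hr]; [lia|].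
  cbn [decode_fuel Nat.add] in *; rewrite Hr, Hq, nfst_npair, nsnd_npair.
  rewrite IHa, IHb by lia; reflexivity.
- cbn [encode] in *.
  destruct (div_mod_4 (encode a) 3) as [Hq Hr]; [lia|].
  cbn [decode_fuel Nat.add] in *; rewrite Hr, Hq.
  rewrite IHa by lia; reflexivity.
Qed.

Lemma decode_encode (c : code) : decode (encode c) = c.
Proof. apply decode_fuel_encode; lia. Qed.

Lemma encode_decode_fuel (k e : nat) :
  e < k -> encode (decode_fuel k e) = e.
Proof.
revert e; induction k as [|k IH]; intros e He; [lia|].
destruct e as [|[|[|[|[|m]]]]]; try reflexivity.
cbn [decode_fuel]; cbv zeta.
assert (Hm := Nat.div_mod_eq m 4).
assert (Hr := Nat.mod_upper_bound m 4).
destruct (npair_bound (nfst (m / 4)) (nsnd (m / 4))) as [B1 B2].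
rewrite npair_nfst_nsnd in B1, B2.
destruct (m mod 4) as [|[|[|[|r]]]]; [| | | |lia]; cbn [encode];
  rewrite !IH by lia; rewrite ?npair_nfst_nsnd; lia.
Qed.

Lemma encode_decode (e : nat) : encode (decode e) = e.
Proof. apply encode_decode_fuel; lia. Qed.

(** [phi_oracle e f x y] is $\varphi_e^f(x) = y$ and [phi e x y] is
    $\varphi_e(x) = y$; the constant oracle adds nothing to the partial
    recursive functions. *)
Definition phi_oracle (e : nat) (f : nat -> nat) (x y : nat) : Prop :=
  eval f (decode e) x y.

Definition phi (e x y : nat) : Prop := phi_oracle e (fun _ => 0) x y.

Definition computable (g : nat -> nat) : Prop :=
  exists e, forall x, phi e x (g x).

(** [phi e] is total and is the characteristic function of [R], pairs being
    coded by [npair]. *)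
Definition is_char_index (e : nat) (R : relation nat) : Prop :=
  forall x y, (R x y -> phi e (npair x y) 1) /\
              (~ R x y -> phi e (npair x y) 0).

Definition computable_lattice_index (e : nat) (le : relation nat) : Prop :=
  is_char_index e le /\ lattice_order le.

Definition algebraic_lattice_indices : Ensemble nat :=
  fun e => exists le : relation nat,
    computable_lattice_index e le /\ algebraic le.

Definition Pi11 (C : Ensemble nat) : Prop :=
  exists e, forall n,
    In nat C n <-> forall f : nat -> nat, exists y, phi_oracle e f n y.

Definition Pi11_hard (A : Ensemble nat) : Prop :=
  forall C : Ensemble nat, Pi11 C ->
  exists g : nat -> nat, computable g /\
    forall n, In nat C n <-> In nat A (g n).

(* Main.v *)
Require Import Defs.
From Stdlib Require Import Arith Lia.
From Stdlib Require Import Relation_Definitions Ensembles Finite_sets.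
From Stdlib Require Import Classical IndefiniteDescription.
From Stdlib Require Import FunctionalExtensionality PropExtensionality.

(** A set is [Pi11] when it consists of the [n] such that some tree of finite
    strings, computable uniformly in [n], has no infinite path: a program [c]
    fails to halt on input [n] with an oracle [f] iff, for every initial segment
    of [f], the computation that knows only this segment of the oracle and whose
    searches are bounded by its length gives no result.  It is therefore enough
    to turn a computable tree into a computable lattice that is algebraic iff
    the tree has no infinite path.

    The lattice is the tree itself, ordered by the ancestor relation, with a top
    element added.  It is always complete: the ancestors of a node form a finite
    chain, so that infima exist, and suprema are infima of upper bounds
    ([tree_le_complete]).

    Without an infinite path every ascending chain of nodes is finite.  Then
    every set has a finite subset with the same upper bounds
    ([accessible_finitely_witnessed]), so every element is compact, and the
    lattice is algebraic ([no_branch_algebraic]).  With an infinite path [s],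
    the supremum of [s] is the top, while the join of finitely many nodes of [s]
    lies on [s]; hence no node off [s] is compact.  A node off [s] just above
    the root, which is thus an atom, is then not a supremum of compact elements
    ([branch_not_algebraic]).

    For the underlying set to be all of [nat], every number has to code a node.
    The strings on which the computation has already halted are not discarded
    but hung directly below the root, as leaves ([tree]); this adds no path, and
    it guarantees that an atom off any given path exists.  The tree is described
    by its parent function alone, so the computability of the order comes down
    to that of the truncated computation ([computable_approx]), and the
    reduction maps [n] to the index given by the s-m-n theorem ([smn]). *)

(** * The lattice of a tree *)

(** Parent functions of trees on [nat] with root 0.  Parents being numerically
    smaller, ancestors are reached after a bounded number of steps, and
    maximality arguments can use the order of numbers. *)
Definition rooted (p : nat -> nat) : Prop := forall x, p x <= pred x.

Definition ancestor (p : nat -> nat) (x y : nat) : Prop :=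
  exists k, Nat.iter k p y = x.

(** The top element is 0, and [S x] stands for the node [x]; the root of the
    tree, which is the bottom element, is thus 1. *)
Definition tree_le (p : nat -> nat) : relation nat :=
  fun a b =>
    match b with
    | 0 => True
    | S y => match a with 0 => False | S x => ancestor p x y end
    end.

(** The second condition excludes only the root as its own child. *)
Definition child (p : nat -> nat) (c x : nat) : Prop := p c = x /\ x < c.

Definition branch (p s : nat -> nat) : Prop :=
  s 0 = 0 /\ forall k, child p (s (S k)) (s k).

Lemma iter_rooted (p : nat -> nat) (k y : nat) :
  rooted p -> Nat.iter k p y <= y - k.
Proof.
intros Hp; induction k as [|k IH]; simpl; [lia|].
specialize (Hp (Nat.iter k p y)); lia.
Qed.

Lemma ancestor_refl (p : nat -> nat) (x : nat) : ancestor p x x.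
Proof. now exists 0. Qed.

Lemma ancestor_trans (p : nat -> nat) (x y z : nat) :
  ancestor p x y -> ancestor p y z -> ancestor p x z.
Proof. intros [i <-] [j <-]; exists (i + j); apply Nat.iter_add. Qed.

Lemma ancestor_le (p : nat -> nat) (x y : nat) :
  rooted p -> ancestor p x y -> x <= y.
Proof. intros Hp [k <-]; assert (H := iter_rooted p k y Hp); lia. Qed.

Lemma ancestor_root (p : nat -> nat) (y : nat) : rooted p -> ancestor p 0 y.
Proof. intros Hp; exists y; assert (H := iter_rooted p y y Hp); lia. Qed.

Lemma ancestor_parent (p : nat -> nat) (x y : nat) :
  ancestor p x y -> x = y \/ ancestor p x (p y).
Proof.
intros [[|k] <-]; [now left|right].
exists k; symmetry; apply Nat.iter_succ_r.
Qed.

Lemma ancestor_comparable (p : nat -> nat) (x y z : nat) :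
  ancestor p x z -> ancestor p y z -> ancestor p x y \/ ancestor p y x.
Proof.
intros [i <-] [j <-].
destruct (Nat.le_ge_cases i j) as [H|H];
  [right; exists (j - i)|left; exists (i - j)];
  rewrite <- Nat.iter_add; f_equal; lia.
Qed.

Lemma ancestor_child (p : nat -> nat) (x y : nat) :
  rooted p -> ancestor p x y -> x <> y ->
  exists c, child p c x /\ ancestor p c y.
Proof.
intros Hp [k Hk] Hxy; induction k as [|k IH]; [now contradiction Hxy|].
simpl in Hk; set (c := Nat.iter k p y) in *.
destruct (Nat.eq_dec c x) as [E|E]; [now apply IH|].
exists c; split; [|now exists k].
split; [easy|]; specialize (Hp c); lia.
Qed.

Lemma tree_le_order (p : nat -> nat) : rooted p -> order nat (tree_le p).
Proof.
intros Hp; split.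
- intros [|x]; simpl; [easy|apply ancestor_refl].
- intros [|x] [|y] [|z]; simpl; try easy; apply ancestor_trans.
- intros [|x] [|y]; simpl; try easy; intros H1 H2.
  apply ancestor_le in H1, H2; trivial; lia.
Qed.

Lemma bounded_max (Q : nat -> Prop) (m N : nat) :
  Q m -> (forall i, Q i -> i <= N) ->
  exists k, Q k /\ forall i, Q i -> i <= k.
Proof.
intros Hm; induction N as [|N IH]; intros HN.
- exists m; split; [easy|]; intros i Hi; apply HN in Hi; lia.
- destruct (classic (Q (S N))) as [H|H]; [now exists (S N)|].
  apply IH; intros i Hi; assert (i <> S N) by congruence.
  apply HN in Hi; lia.
Qed.

(** If the set contains a node [y], its lower bounds are ancestors of [y], and
    the root is one of them.  They form a finite chain; its numerically largest
    element is the infimum. *)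
Lemma tree_le_inf (p : nat -> nat) (A : Ensemble nat) :
  rooted p -> exists i, is_inf (tree_le p) A i.
Proof.
intros Hp.
destruct (classic (exists y, In nat A (S y))) as [[y Hy]|H].
- destruct (bounded_max (fun x => lower_bound (tree_le p) A (S x)) 0 y)
    as (x & Hx & Mx).
  + intros [|z] _; simpl; [easy|now apply ancestor_root].
  + intros x Hx; exact (ancestor_le p x y Hp (Hx _ Hy)).
  + exists (S x); split; [exact Hx|].
    intros [|l] Hl; [exact (Hl _ Hy)|]; simpl.
    destruct (ancestor_comparable p l x y (Hl _ Hy) (Hx _ Hy)) as [E|E];
      [exact E|].
    apply Mx in Hl; apply ancestor_le in E; trivial.
    replace l with x by lia; apply ancestor_refl.
- exists 0; split; [|easy].
  intros [|y] Hy; [easy|now destruct H; exists y].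
Qed.

Lemma inf_upper_bounds_is_sup {L : Type} (le : relation L) (A : Ensemble L)
    (s : L) :
  is_inf le (fun u => upper_bound le A u) s -> is_sup le A s.
Proof.
intros [H1 H2]; split.
- intros x Hx; apply H2; intros u Hu; exact (Hu x Hx).
- intros u Hu; exact (H1 u Hu).
Qed.

Lemma tree_le_complete (p : nat -> nat) : rooted p -> complete (tree_le p).
Proof.
intros Hp A; split; [|now apply tree_le_inf].
destruct (tree_le_inf p (fun u => upper_bound (tree_le p) A u) Hp) as [s Hs].
exists s; now apply inf_upper_bounds_is_sup.
Qed.

Lemma tree_le_lattice (p : nat -> nat) : rooted p -> lattice_order (tree_le p).
Proof.
intros Hp; split; [now apply tree_le_order|].
intros x y; now apply tree_le_complete.
Qed.

(** An inaccessible node has an inaccessible child; choosing such children from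
    the root on yields a branch. *)
Lemma no_branch_wf (p : nat -> nat) :
  (forall s, ~ branch p s) -> Acc (child p) 0.
Proof.
intros Hb; apply NNPP; intros H0.
assert (step : forall x, exists c,
  ~ Acc (child p) x -> child p c x /\ ~ Acc (child p) c).
{ intros x; destruct (classic (exists c, child p c x /\ ~ Acc (child p) c))
    as [[c Hc]|H]; [now exists c|].
  exists 0; intros Hx; destruct Hx; constructor; intros c Hc.
  apply NNPP; intros Hc'; apply H; now exists c. }
destruct (functional_choice _ step) as [next Hnext].
assert (Hs : forall k, ~ Acc (child p) (Nat.iter k next 0)).
{ intros k; induction k as [|k IH]; [exact H0|]; now apply Hnext. }
apply (Hb (fun k => Nat.iter k next 0)); split; [easy|].
intros k; now apply Hnext.
Qed.

(** Suprema depend only on the upper bounds, and working with the latter avoids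
    constructing any supremum. *)
Definition same_upper_bounds {L : Type} (le : relation L) (A B : Ensemble L)
  : Prop := forall u, upper_bound le A u <-> upper_bound le B u.

Lemma below_sup_same_upper_bounds {L : Type} (le : relation L) (a : L)
    (A B : Ensemble L) :
  same_upper_bounds le A B -> below_sup le a A -> below_sup le a B.
Proof.
intros E (s & [H1 H2] & Ha); exists s; split; [split|exact Ha].
- now apply E.
- intros u Hu; apply H2; now apply E.
Qed.

Definition finitely_witnessed (p : nat -> nat) (A : Ensemble nat) : Prop :=
  exists B, Finite nat B /\ Included nat B A /\
            same_upper_bounds (tree_le p) A B.

Lemma max_finitely_witnessed (p : nat -> nat) (A : Ensemble nat) (m : nat) :
  rooted p -> In nat A m -> upper_bound (tree_le p) A m ->
  finitely_witnessed p A.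
Proof.
intros Hp HA Hm; exists (Add nat (Empty_set nat) m).
split; [apply Union_is_finite; [constructor|now intros []]|].
split; [now intros x [x' []|x' []]|]; intros u; split; intros Hu.
- intros x [x' []|x' []]; now apply Hu.
- intros x Hx; apply (ord_trans _ _ (tree_le_order p Hp) _ m).
  + now apply Hm.
  + apply Hu; right; constructor.
Qed.

(** The induction climbs the tree along a node [x] below some element [y] of
    [A].  Once [y] itself is reached, either [y] is the maximum of [A], or [A]
    has an element strictly above [y] and the climb goes on, or [A] has an
    element incomparable to [y], and these two elements already have the top as
    their only upper bound. *)
Lemma accessible_finitely_witnessed (p : nat -> nat) (x : nat) :
  rooted p -> Acc (child p) x ->
  forall (A : Ensemble nat) (y : nat),
  In nat A (S y) -> ancestor p x y -> finitely_witnessed p A.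
Proof.
intros Hp Hx; induction Hx as [x _ IH]; intros A y HA Hxy.
destruct (Nat.eq_dec x y) as [->|E].
2:{ destruct (ancestor_child p x y Hp Hxy E) as (c & Hc & Hcy).
    now apply (IH c Hc A y). }
destruct (classic (upper_bound (tree_le p) A (S y))) as [H|H];
  [now apply (max_finitely_witnessed p A (S y))|].
apply not_all_ex_not in H as [[|z] H]; apply imply_to_and in H as [HzA Hz].
- now apply (max_finitely_witnessed p A 0).
- destruct (classic (ancestor p y z)) as [Hyz|Hyz].
  + assert (E : y <> z) by (intros ->; apply Hz, ancestor_refl).
    destruct (ancestor_child p y z Hp Hyz E) as (c & Hc & Hcz).
    now apply (IH c Hc A z).
  + exists (Add nat (Add nat (Empty_set nat) (S y)) (S z)).
    assert (Hne : ~ In nat (Add nat (Empty_set nat) (S y)) (S z)).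
    { intros H; apply Hz; inversion H as [? []|w Hw]; subst.
      destruct Hw; apply ancestor_refl. }
    split; [|split].
    { apply Union_is_finite; [|exact Hne].
      apply Union_is_finite; [constructor|now intros []]. }
    { now intros w [w' [w'' []|w'' []]|w' []]. }
    intros u; split; intros Hu.
    * intros w [w' [w'' []|w'' []]|w' []]; now apply Hu.
    * destruct u as [|u]; [now intros w _|].
      assert (H1 : ancestor p y u)
        by (apply (Hu (S y)); left; right; constructor).
      assert (H2 : ancestor p z u) by (apply (Hu (S z)); right; constructor).
      now destruct (ancestor_comparable p y z u H1 H2).
Qed.

Lemma no_branch_algebraic (p : nat -> nat) :
  rooted p -> (forall s, ~ branch p s) -> algebraic (tree_le p).
Proof.
intros Hp Hb; split; [now apply tree_le_complete|].
assert (HF : forall A, finitely_witnessed p A).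
{ intros A; destruct (classic (exists y, In nat A (S y))) as [[y Hy]|H].
  - apply (accessible_finitely_witnessed p 0 Hp) with y;
      [now apply no_branch_wf|exact Hy|now apply ancestor_root].
  - destruct (classic (In nat A 0)) as [H0|H0];
      [now apply (max_finitely_witnessed p A 0)|].
    exists (Empty_set nat); split; [constructor|]; split; [now intros x []|].
    intros u; split; intros _ [|x] Hx; try easy.
    now destruct H; exists x. }
intros x; exists (Singleton nat x); split.
- intros y [] A HA; destruct (HF A) as (B & HB & HBA & E).
  exists B; repeat split; trivial.
  now apply (below_sup_same_upper_bounds _ _ A).
- split.
  + intros y []; now apply (ord_refl _ _ (tree_le_order p Hp)).
  + intros u Hu; apply Hu; constructor.
Qed.

Lemma branch_ge (p s : nat -> nat) (k : nat) : branch p s -> k <= s k.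
Proof.
intros [H0 H]; induction k as [|k IH]; [lia|].
destruct (H k); lia.
Qed.

Lemma branch_mono (p s : nat -> nat) (i j : nat) :
  branch p s -> i <= j -> ancestor p (s i) (s j).
Proof.
intros [H0 H]; induction 1 as [|j Hj IH]; [apply ancestor_refl|].
apply (ancestor_trans _ _ _ _ IH); exists 1; apply H.
Qed.

Lemma ancestor_of_branch (p s : nat -> nat) (a k : nat) :
  rooted p -> branch p s -> ancestor p a (s k) -> exists j, a = s j.
Proof.
intros Hp [H0 H]; induction k as [|k IH]; intros Ha;
  destruct (ancestor_parent p _ _ Ha) as [->|Ha']; try (now eexists).
- rewrite H0 in Ha; apply ancestor_le in Ha; trivial.
  exists 0; lia.
- apply IH; now rewrite <- (proj1 (H k)).
Qed.

(** A branch is a chain, so the highest of finitely many of its nodes bounds the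
    others. *)
Lemma finite_below_branch (p s : nat -> nat) (B : Ensemble nat) :
  branch p s -> Finite nat B ->
  Included nat B (fun x => exists k, x = S (s k)) ->
  exists k, upper_bound (tree_le p) B (S (s k)).
Proof.
intros Hs; induction 1 as [|B HB IH x Hx]; intros HI.
- exists 0; now intros x [].
- destruct IH as [k Hk]; [intros y Hy; apply HI; now left|].
  destruct (HI x) as [j ->]; [now right|].
  exists (max j k); intros y [y' Hy|y' []].
  + specialize (Hk y' Hy); destruct y' as [|y']; [easy|].
    simpl in *; apply (ancestor_trans _ _ _ _ Hk).
    apply branch_mono; trivial; lia.
  + simpl; apply branch_mono; trivial; lia.
Qed.

(** The supremum of the branch is the top, since node numbers grow along the
    branch beyond any candidate for a bound.  Finitely many nodes of the branch
    are bounded by a single one, all of whose ancestors lie on the branch. *)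
Lemma off_branch_not_compact (p s : nat -> nat) (a : nat) :
  rooted p -> branch p s -> (forall k, a <> s k) ->
  ~ compact (tree_le p) (S a).
Proof.
intros Hp Hs Ha Hc.
destruct (Hc (fun x => exists k, x = S (s k))) as (B & HB & HI & t & Ht & Hat).
- exists 0; split; [|easy]; split; [easy|].
  intros [|u] Hu; [easy|].
  assert (H : tree_le p (S (s (S u))) (S u)) by (apply Hu; now exists (S u)).
  apply ancestor_le in H; trivial.
  assert (H' := branch_ge p s (S u) Hs); lia.
- destruct (finite_below_branch p s B Hs HB HI) as [k Hk].
  apply Ht in Hk.
  assert (H := ord_trans _ _ (tree_le_order p Hp) _ _ _ Hat Hk).
  destruct (ancestor_of_branch p s a k Hp Hs H) as [j E].
  now apply (Ha j).
Qed.

(** The only other element below the atom [S a] is the bottom, so [S a] would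
    have to be compact itself. *)
Lemma branch_not_algebraic (p s : nat -> nat) (a : nat) :
  rooted p -> branch p s -> p a = 0 -> (forall k, a <> s k) ->
  ~ algebraic (tree_le p).
Proof.
intros Hp Hs Ha Hoff [_ HG].
destruct (HG (S a)) as (A & HA & H1 & H2).
assert (H : tree_le p (S a) (S 0)).
{ apply H2; intros x Hx; specialize (H1 x Hx); destruct x as [|x]; [easy|].
  simpl in *; destruct (ancestor_parent p x a H1) as [->|E].
  - now destruct (off_branch_not_compact p s a Hp Hs Hoff); apply HA.
  - now rewrite Ha in E. }
apply ancestor_le in H; trivial.
destruct Hs as [H0 _]; apply (Hoff 0); lia.
Qed.

(** * Computable functions *)

Lemma computable_of_code (c : code) (g : nat -> nat) :
  (forall x, eval (fun _ => 0) c x (g x)) -> computable g.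
Proof.
intros H; exists (encode c); intros x; unfold phi, phi_oracle.
rewrite decode_encode; apply H.
Qed.

Lemma computable_ext (g h : nat -> nat) :
  (forall x, g x = h x) -> computable g -> computable h.
Proof. intros E [e He]; exists e; intros x; rewrite <- E; apply He. Qed.

Lemma computable_id : computable (fun x => x).
Proof.
apply (computable_of_code (Pair Fst Snd)); intros x.
exists (nfst x), (nsnd x); simpl; repeat split.
symmetry; apply npair_nfst_nsnd.
Qed.

Lemma computable_comp (g h : nat -> nat) :
  computable g -> computable h -> computable (fun x => g (h x)).
Proof.
intros [e He] [d Hd]; apply (computable_of_code (Comp (decode e) (decode d))).
intros x; exists (h x); split; [apply Hd|apply He].
Qed.

Lemma computable_succ (g : nat -> nat) :
  computable g -> computable (fun x => S (g x)).
Proof. apply computable_comp; now apply (computable_of_code Succ). Qed.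

Lemma computable_const (n : nat) : computable (fun _ => n).
Proof.
induction n as [|n IH]; [now apply (computable_of_code Zero)|].
now apply computable_succ.
Qed.

Lemma computable_nfst (g : nat -> nat) :
  computable g -> computable (fun x => nfst (g x)).
Proof. apply computable_comp; now apply (computable_of_code Fst). Qed.

Lemma computable_nsnd (g : nat -> nat) :
  computable g -> computable (fun x => nsnd (g x)).
Proof. apply computable_comp; now apply (computable_of_code Snd). Qed.

Lemma computable_npair (g h : nat -> nat) :
  computable g -> computable h -> computable (fun x => npair (g x) (h x)).
Proof.
intros [e He] [d Hd]; apply (computable_of_code (Pair (decode e) (decode d))).
intros x; exists (g x), (h x); split; [apply He|]; split; [apply Hd|easy].
Qed.

(** The Cantor pairing codes the arguments; triples associate to the right, as
    in the inputs that [Prec] passes to its step program. *)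
Definition computable2 (F : nat -> nat -> nat) : Prop :=
  computable (fun w => F (nfst w) (nsnd w)).

Definition computable3 (F : nat -> nat -> nat -> nat) : Prop :=
  computable (fun w => F (nfst w) (nfst (nsnd w)) (nsnd (nsnd w))).

Lemma computable2_app (F : nat -> nat -> nat) (g h : nat -> nat) :
  computable2 F -> computable g -> computable h ->
  computable (fun x => F (g x) (h x)).
Proof.
intros HF Hg Hh.
refine (computable_ext _ _ _
  (computable_comp _ _ HF (computable_npair _ _ Hg Hh))).
intros x; now rewrite nfst_npair, nsnd_npair.
Qed.

Lemma computable_rec (a n : nat -> nat) (b : nat -> nat -> nat -> nat) :
  computable a -> computable n -> computable3 b ->
  computable (fun x => nat_rect (fun _ => nat) (a x) (b x) (n x)).
Proof.
intros [e He] Hn [d Hd].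
assert (HP : computable2 (fun x m => nat_rect (fun _ => nat) (a x) (b x) m)).
{ apply (computable_of_code (Prec (decode e) (decode d))); intros w; simpl.
  induction (nsnd w) as [|k IH]; simpl; [apply He|].
  eexists; split; [exact IH|].
  specialize (Hd (npair (nfst w) (npair k
    (nat_rect (fun _ => nat) (a (nfst w)) (b (nfst w)) k)))).
  now rewrite !nsnd_npair, !nfst_npair in Hd. }
exact (computable2_app _ _ _ HP computable_id Hn).
Qed.

Lemma computable_case (u a : nat -> nat) (b : nat -> nat -> nat) :
  computable u -> computable a -> computable2 b ->
  computable (fun x => match u x with 0 => a x | S k => b x k end).
Proof.
intros Hu Ha Hb.
assert (Hr := computable_rec a u (fun x k _ => b x k) Ha Hu).
refine (computable_ext _ _ _ (Hr _)); [intros x; now destruct (u x)|].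
apply (computable2_app b); trivial.
- apply computable_nfst, computable_id.
- apply computable_nfst, computable_nsnd, computable_id.
Qed.

Create HintDb computable.
Ltac computability := auto 20 with computable.

#[local] Hint Resolve computable_id computable_const computable_succ
  computable_nfst computable_nsnd computable_npair : computable.
#[local] Hint Unfold computable2 computable3 : computable.

Lemma computable_pred (g : nat -> nat) :
  computable g -> computable (fun x => pred (g x)).
Proof.
intros Hg; refine (computable_ext _ _ _
  (computable_case g (fun _ => 0) (fun _ k => k) Hg _ _)); computability.
intros x; now destruct (g x).
Qed.
#[local] Hint Resolve computable_pred : computable.

Lemma computable_add (g h : nat -> nat) :
  computable g -> computable h -> computable (fun x => g x + h x).
Proof.
intros Hg Hh.
refine (computable_ext _ _ _
  (computable_rec h g (fun _ _ r => S r) Hh Hg _)).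
- intros x; induction (g x) as [|k IH]; simpl; congruence.
- computability.
Qed.

Lemma computable_sub (g h : nat -> nat) :
  computable g -> computable h -> computable (fun x => g x - h x).
Proof.
intros Hg Hh.
refine (computable_ext _ _ _
  (computable_rec g h (fun _ _ r => pred r) Hg Hh _)).
- intros x; induction (h x) as [|k IH]; simpl; lia.
- computability.
Qed.
#[local] Hint Resolve computable_add computable_sub : computable.

Lemma computable_iter (F : nat -> nat -> nat) (u n g : nat -> nat) :
  computable2 F -> computable u -> computable n -> computable g ->
  computable (fun x => Nat.iter (n x) (F (u x)) (g x)).
Proof.
intros HF Hu Hn Hg.
refine (computable_rec g n (fun x _ r => F (u x) r) Hg Hn _).
apply (computable2_app F); computability.
apply (computable_comp u); computability.
Qed.

Fixpoint const_code (n : nat) : code :=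
  match n with 0 => Zero | S n => Comp Succ (const_code n) end.

Lemma eval_const_code (f : nat -> nat) (n x : nat) :
  eval f (const_code n) x n.
Proof. induction n as [|n IH]; simpl; [easy|]; now exists n. Qed.

Lemma computable_encode_const :
  computable (fun n => encode (const_code n)).
Proof.
refine (computable_ext _ _ _ (computable_rec (fun _ => 0) (fun n => n)
  (fun _ _ r => 6 + (npair 1 r + (npair 1 r + (npair 1 r + npair 1 r))))
  _ _ _)); computability.
intros n; induction n as [|n IH]; [easy|].
cbn [nat_rect const_code encode]; rewrite IH; lia.
Qed.

(** A program for [fun n x => F n x] is specialized to a value of [n] by feeding
    it the output of a constant program; the code of the result is arithmetic
    in [n]. *)
Lemma smn (F : nat -> nat -> nat) :
  computable2 F ->
  exists g, computable g /\ forall n x, phi (g n) x (F n x).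
Proof.
intros [e He].
exists (fun n => encode (Comp (decode e)
  (Pair (const_code n) (Pair Fst Snd)))); split.
- cbn [encode]; generalize (encode (decode e)); intros d.
  assert (H4 : forall h, computable h -> computable (fun x => 4 * h x)).
  { intros h Hh.
    refine (computable_ext (fun x => h x + (h x + (h x + h x))) _ _ _);
      [intros x; lia|computability]. }
  (* The code of [Pair Fst Snd], which computes the identity. *)
  set (i := 5 + 4 * npair 2 3); cbn [Nat.add].
  do 6 apply computable_succ; apply H4, computable_npair;
    [apply computable_const|].
  do 5 apply computable_succ; apply H4, computable_npair;
    [apply computable_encode_const|apply computable_const].
- intros n x; unfold phi, phi_oracle; rewrite decode_encode.
  exists (npair n x); split.
  + exists n, x; split; [apply eval_const_code|]; split; [|easy].
    exists (nfst x), (nsnd x); split; [easy|]; split; [easy|].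
    now rewrite npair_nfst_nsnd.
  + specialize (He (npair n x)).
    now rewrite nfst_npair, nsnd_npair in He.
Qed.

(** * Truncated computations *)

(** Values of partial functions are coded in [nat], with 0 for undefined and
    [S v] for the value [v].  The state [st] of the search for a zero is 0 as
    long as all values have been positive, 1 after an undefined value, and
    [S (S y)] once a zero has been found at [y]; the predecessor of the final
    state is the coded result. *)
Definition search_step (j st v : nat) : nat :=
  match st with
  | 0 =>
      match v with
      | 0 => 1
      | S w => match w with 0 => S (S j) | S _ => 0 end
      end
  | S _ => st
  end.

Definition search (h : nat -> nat) (m : nat) : nat :=
  nat_rect (fun _ => nat) 0 (fun j st => search_step j st (h j)) m.

Lemma search_pending (h : nat -> nat) (m : nat) :
  search h m = 0 -> forall i, i < m -> 2 <= h i.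
Proof.
induction m as [|m IH]; simpl; [lia|].
fold (search h m); unfold search_step.
destruct (search h m); [|easy].
destruct (h m) as [|[|v]] eqn:E; try easy; intros _ i Hi.
destruct (Nat.eq_dec i m) as [->|]; [lia|]; apply IH; lia.
Qed.

Lemma search_found (h : nat -> nat) (m y : nat) :
  search h m = S (S y) -> y < m /\ h y = 1 /\ forall i, i < y -> 2 <= h i.
Proof.
induction m as [|m IH]; simpl; [easy|].
assert (Hp := search_pending h m).
fold (search h m); unfold search_step.
destruct (search h m) as [|st] eqn:E; intros H.
- destruct (h m) as [|[|v]] eqn:Em; try easy.
  injection H as <-; auto.
- destruct (IH H) as (H1 & H2 & H3); auto with arith.
Qed.

Lemma search_complete (h : nat -> nat) (m y : nat) :
  y < m -> h y = 1 -> (forall i, i < y -> 2 <= h i) -> search h m = S (S y).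
Proof.
intros Hm Hy Hi.
assert (H0 : forall j, j <= y -> search h j = 0).
{ induction j as [|j IH]; simpl; [easy|]; intros Hj.
  fold (search h j); rewrite IH by lia.
  specialize (Hi j Hj); destruct (h j) as [|[|v]]; try lia; reflexivity. }
induction Hm as [|m Hm IH]; simpl.
- fold (search h y); now rewrite H0, Hy.
- fold (search h m); now rewrite IH.
Qed.

(** The evaluation of [c] with a partial oracle [q], in which unbounded searches
    are cut off at [m]: no other construct can run forever.  Unlike [eval], this
    is a total function. *)
Fixpoint approx (q : nat -> nat) (m : nat) (c : code) (x : nat) : nat :=
  match c with
  | Zero => 1
  | Succ => S (S x)
  | Fst => S (nfst x)
  | Snd => S (nsnd x)
  | Oracle => q x
  | Pair a b =>
      match approx q m a x with
      | 0 => 0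
      | S u => match approx q m b x with 0 => 0 | S v => S (npair u v) end
      end
  | Comp a b =>
      match approx q m b x with 0 => 0 | S u => approx q m a u end
  | Prec a b =>
      nat_rect (fun _ => nat) (approx q m a (nfst x))
        (fun k r =>
           match r with
           | 0 => 0
           | S r => approx q m b (npair (nfst x) (npair k r))
           end)
        (nsnd x)
  | Mu a => pred (search (fun i => approx q m a (npair x i)) m)
  end.

Definition extends (q q' : nat -> nat) : Prop :=
  forall k v, q k = S v -> q' k = S v.

Lemma approx_mono (q q' : nat -> nat) (m m' : nat) (c : code) :
  extends q q' -> m <= m' -> extends (approx q m c) (approx q' m' c).
Proof.
intros Hq Hm.
induction c as [| | | | |a IHa b IHb|a IHa b IHb|a IHa b IHb|a IHa];
  intros x y; simpl; auto.
- destruct (approx q m a x) as [|u] eqn:Ea; [easy|].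
  destruct (approx q m b x) as [|v] eqn:Eb; [easy|].
  now rewrite (IHa _ _ Ea), (IHb _ _ Eb).
- destruct (approx q m b x) as [|u] eqn:Eb; [easy|].
  rewrite (IHb _ _ Eb); apply IHa.
- revert y; induction (nsnd x) as [|k IH]; simpl; intros y; [apply IHa|].
  set (r := nat_rect _ _ _ k) in *; destruct r as [|r]; [easy|].
  rewrite (IH r); trivial; apply IHb.
- intros H.
  destruct (search (fun i => approx q m a (npair x i)) m) as [|[|z]] eqn:E;
    try easy.
  injection H as ->; apply search_found in E as (H1 & H2 & H3).
  rewrite search_complete with (y := y); trivial; [lia|now apply IHa|].
  intros i Hi; specialize (H3 i Hi).
  destruct (approx q m a (npair x i)) as [|[|v]] eqn:E; try lia.
  rewrite (IHa _ _ E); lia.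
Qed.

Lemma approx_sound (f q : nat -> nat) (m : nat) (c : code) (x y : nat) :
  (forall k v, q k = S v -> v = f k) -> approx q m c x = S y -> eval f c x y.
Proof.
intros Hq; revert x y.
induction c as [| | | | |a IHa b IHb|a IHa b IHb|a IHa b IHb|a IHa];
  intros x y; simpl; try congruence; auto.
- destruct (approx q m a x) as [|u] eqn:Ea; [easy|].
  destruct (approx q m b x) as [|v] eqn:Eb; [easy|].
  intros H; injection H as <-; exists u, v; auto.
- destruct (approx q m b x) as [|u] eqn:Eb; [easy|]; eauto.
- revert y; induction (nsnd x) as [|k IH]; simpl; intros y; [apply IHa|].
  set (r := nat_rect _ _ _ k) in *; destruct r as [|r]; [easy|].
  intros H; exists r; auto.
- intros H.
  destruct (search (fun i => approx q m a (npair x i)) m) as [|[|z]] eqn:E;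
    try easy.
  injection H as ->; apply search_found in E as (_ & H2 & H3).
  split; [now apply IHa|]; intros i Hi; specialize (H3 i Hi).
  destruct (approx q m a (npair x i)) as [|[|v]] eqn:E; try lia.
  exists v; now apply IHa.
Qed.

(** The finitely many tests made by a successful search may be settled at
    different stages; this provides a common one. *)
Lemma bounded_stage (Q : nat -> nat -> Prop) (n : nat) :
  (forall i m m', m <= m' -> Q i m -> Q i m') ->
  (forall i, i < n -> exists m, Q i m) ->
  exists m, forall i, i < n -> Q i m.
Proof.
intros HQ; induction n as [|n IH]; intros H; [exists 0; lia|].
destruct IH as [m Hm]; [auto with arith|].
destruct (H n) as [m' Hm']; [lia|].
exists (max m m'); intros i Hi.
destruct (Nat.eq_dec i n) as [->|E].
- apply (HQ n m'); [lia|easy].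
- apply (HQ i m); [lia|]; apply Hm; lia.
Qed.

(** A halting computation asks finitely many questions to the oracle and makes
    finitely many bounded searches. *)
Lemma approx_complete (f : nat -> nat) (q : nat -> nat -> nat) (c : code)
    (x y : nat) :
  (forall m m', m <= m' -> extends (q m) (q m')) ->
  (forall k, exists m, q m k = S (f k)) ->
  eval f c x y -> exists m, approx (q m) m c x = S y.
Proof.
intros Hmono Hlim.
assert (mono : forall m m' c x y, m <= m' ->
  approx (q m) m c x = S y -> approx (q m') m' c x = S y).
{ intros m m' d z v Hm; apply approx_mono; auto. }
revert x y.
induction c as [| | | | |a IHa b IHb|a IHa b IHb|a IHa b IHb|a IHa];
  intros x y; simpl; try (intros ->; exists 0; reflexivity).
- now intros ->.
- intros (u & v & Hu & Hv & ->).
  destruct (IHa _ _ Hu) as [i Hi], (IHb _ _ Hv) as [j Hj].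
  exists (max i j); rewrite (mono i _ a x u), (mono j _ b x v); trivial; lia.
- intros (u & Hu & Hy).
  destruct (IHb _ _ Hu) as [i Hi], (IHa _ _ Hy) as [j Hj].
  exists (max i j); rewrite (mono i _ b x u), (mono j _ a u y); trivial; lia.
- (* The recursion counter is read off the input, so the induction runs over
     the inputs [npair (nfst x) k]. *)
  assert (H : forall k y,
    eval f (Prec a b) (npair (nfst x) k) y ->
    exists m, approx (q m) m (Prec a b) (npair (nfst x) k) = S y).
  { intros k; induction k as [|k IH]; simpl; rewrite nfst_npair, nsnd_npair;
      simpl; intros z; [apply IHa|].
    intros (r & Hr & Hz).
    assert (Hr' : eval f (Prec a b) (npair (nfst x) k) r)
      by (simpl; now rewrite nfst_npair, nsnd_npair).
    destruct (IH r Hr') as [i Hi], (IHb _ _ Hz) as [j Hj].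
    exists (max i j).
    apply (mono i (max i j)) in Hi; [|lia].
    simpl in Hi; rewrite nfst_npair, nsnd_npair in Hi; rewrite Hi.
    apply (mono j); [lia|easy]. }
  specialize (H (nsnd x) y); rewrite npair_nfst_nsnd in H; exact H.
- intros [Hy Hlt].
  destruct (IHa _ _ Hy) as [j Hj].
  destruct (bounded_stage
    (fun i m => exists v, approx (q m) m a (npair x i) = S (S v)) y)
    as [i Hi].
  + intros i m m' Hm [v Hv]; exists v; now apply (mono m).
  + intros i Hi; destruct (Hlt i Hi) as [v Hv].
    destruct (IHa _ _ Hv) as [m Hm]; now exists m, v.
  + exists (max (S y) (max i j)).
    rewrite search_complete with (y := y); trivial; [lia| |].
    * apply (mono j); [lia|easy].
    * intros k Hk; destruct (Hi k Hk) as [v Hv].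
      apply (mono i (max (S y) (max i j))) in Hv; [|lia]; rewrite Hv; lia.
Qed.

Lemma computable_search_step (j st v : nat -> nat) :
  computable j -> computable st -> computable v ->
  computable (fun x => search_step (j x) (st x) (v x)).
Proof.
intros Hj Hs Hv; unfold search_step.
refine (computable_ext _ _ _ (computable_case st
  (fun x => match v x with
            | 0 => 1
            | S w => match w with 0 => S (S (j x)) | S _ => 0 end
            end) (fun _ k => S k) Hs _ _)); computability.
{ intros x; now destruct (st x). }
apply (computable_case v (fun _ => 1)
  (fun x w => match w with 0 => S (S (j x)) | S _ => 0 end));
  computability.
apply (computable_case nsnd (fun x => S (S (j (nfst x)))) (fun _ _ => 0));
  computability.
do 2 apply computable_succ; apply (computable_comp j); computability.
Qed.

Lemma computable_approx (q : nat -> nat -> nat) (m : nat -> nat) (c : code) :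
  computable2 q -> computable m ->
  computable2 (fun s x => approx (q s) (m s) c x).
Proof.
intros Hq Hm; unfold computable2.
induction c as [| | | | |a IHa b IHb|a IHa b IHb|a IHa b IHb|a IHa];
  simpl; computability.
- apply (computable_case _ (fun _ => 0) (fun w u =>
    match approx (q (nfst w)) (m (nfst w)) b (nsnd w) with
    | 0 => 0
    | S v => S (npair u v)
    end)); computability.
  apply (computable_case _ (fun _ => 0) (fun w v => S (npair (nsnd w) v)));
    computability.
  apply (computable_comp _ nfst IHb); computability.
- apply (computable_case _ (fun _ => 0) (fun w u =>
    approx (q (nfst w)) (m (nfst w)) a u)); computability.
  apply (computable2_app (fun s u => approx (q s) (m s) a u));
    computability.
- apply (computable_rec
    (fun w => approx (q (nfst w)) (m (nfst w)) a (nfst (nsnd w)))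
    (fun w => nsnd (nsnd w))
    (fun w k r =>
       match r with
       | 0 => 0
       | S r =>
           approx (q (nfst w)) (m (nfst w)) b
             (npair (nfst (nsnd w)) (npair k r))
       end)); computability.
  + apply (computable2_app (fun s u => approx (q s) (m s) a u));
    computability.
  + unfold computable3.
    apply (computable_case _ (fun _ => 0) (fun w r =>
      approx (q (nfst (nfst w))) (m (nfst (nfst w))) b
        (npair (nfst (nsnd (nfst w))) (npair (nfst (nsnd w)) r))));
    computability.
    apply (computable2_app (fun s u => approx (q s) (m s) b u));
    computability.
- apply computable_pred.
  apply (computable_rec (fun _ => 0) (fun w => m (nfst w)) (fun w j st =>
    search_step j st (approx (q (nfst w)) (m (nfst w)) a (npair (nsnd w) j))));
    computability.
  + apply (computable_comp m); computability.
  + apply computable_search_step; computability.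
    apply (computable2_app (fun s u => approx (q s) (m s) a u));
      computability.
Qed.

(** * Finite strings *)

(** Every number codes a string: 0 is the empty string, and [S (npair x v)] is
    the string [x] followed by the entry [v]. *)
Fixpoint prefix (f : nat -> nat) (m : nat) : nat :=
  match m with 0 => 0 | S m => S (npair (prefix f m) (f m)) end.

Definition butlast (x : nat) : nat := nfst (pred x).

(** Counting up to [x] gives the length, a string being no longer than its code.
    Unlike a recursion on the string itself, whose argument changes at each
    step, the count has the form required by [computable_rec]. *)
Definition count_nonempty (n x : nat) : nat :=
  nat_rect (fun _ => nat) 0
    (fun i r => match Nat.iter i butlast x with 0 => r | S _ => S r end) n.

Definition len (x : nat) : nat := count_nonempty x x.

(** The entry at position [k] is the last one of the initial segment of length
    [k + 1]; as in [approx], 0 stands for an undefined entry. *)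
Definition read (x k : nat) : nat :=
  match len x - k with
  | 0 => 0
  | S d => S (nsnd (pred (Nat.iter d butlast x)))
  end.

Lemma rooted_butlast : rooted butlast.
Proof.
intros x; unfold butlast; rewrite <- (npair_nfst_nsnd (pred x)) at 2.
apply npair_bound.
Qed.

Lemma count_nonempty_stable (n x : nat) :
  x <= n -> count_nonempty n x = len x.
Proof.
induction 1 as [|n Hn IH]; [easy|]; simpl.
assert (H := iter_rooted butlast n x rooted_butlast).
replace (Nat.iter n butlast x) with 0 by lia; exact IH.
Qed.

Lemma count_nonempty_succ (n z : nat) :
  count_nonempty (S n) (S z) = S (count_nonempty n (nfst z)).
Proof.
induction n as [|n IH]; [easy|].
change (count_nonempty (S (S n)) (S z)) with
  (match Nat.iter (S n) butlast (S z) with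
   | 0 => count_nonempty (S n) (S z)
   | S _ => S (count_nonempty (S n) (S z))
   end).
rewrite IH, Nat.iter_succ_r.
change (butlast (S z)) with (nfst z); simpl; fold (count_nonempty n (nfst z)).
now destruct (Nat.iter n butlast (nfst z)).
Qed.

Lemma len_succ (z : nat) : len (S z) = S (len (nfst z)).
Proof.
unfold len at 1; rewrite count_nonempty_succ; f_equal.
apply count_nonempty_stable; apply (rooted_butlast (S z)).
Qed.

Lemma read_succ_extends (z : nat) : extends (read (nfst z)) (read (S z)).
Proof.
intros k v; unfold read; rewrite len_succ.
destruct (len (nfst z) - k) as [|d] eqn:E; [easy|].
replace (S (len (nfst z)) - k) with (S (S d)) by lia.
now rewrite Nat.iter_succ_r.
Qed.

Lemma read_last (z : nat) : read (S z) (len (nfst z)) = S (nsnd z).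
Proof. unfold read; now rewrite len_succ, Nat.sub_succ_l, Nat.sub_diag. Qed.

Lemma len_prefix (f : nat -> nat) (m : nat) : len (prefix f m) = m.
Proof.
induction m as [|m IH]; [easy|]; simpl.
now rewrite len_succ, nfst_npair, IH.
Qed.

Lemma read_prefix (f : nat -> nat) (m k : nat) :
  k < m -> read (prefix f m) k = S (f k).
Proof.
induction 1 as [|m Hm IH]; simpl.
- assert (H := read_last (npair (prefix f k) (f k))).
  now rewrite nfst_npair, nsnd_npair, len_prefix in H.
- apply read_succ_extends; now rewrite nfst_npair.
Qed.

Lemma read_prefix_sound (f : nat -> nat) (m k v : nat) :
  read (prefix f m) k = S v -> v = f k.
Proof.
destruct (Nat.lt_ge_cases k m) as [H|H].
- rewrite read_prefix by easy; congruence.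
- unfold read; rewrite len_prefix; now replace (m - k) with 0 by lia.
Qed.

Lemma read_prefix_mono (f : nat -> nat) (m m' : nat) :
  m <= m' -> extends (read (prefix f m)) (read (prefix f m')).
Proof.
induction 1 as [|m' Hm IH]; intros k v Hk; [easy|]; simpl.
apply read_succ_extends; rewrite nfst_npair; now apply IH.
Qed.

(** * The tree of undecided computations *)

(** The length of the string also serves as the bound on searches, so that both
    resources grow along a path. *)
Definition run (c : code) (n x : nat) : nat := approx (read x) (len x) c n.

(** Nonempty strings on which [c] has already halted are hung at the root: no
    path goes through them, and every number remains a node. *)
Definition tree (c : code) (n x : nat) : nat :=
  match run c n x with 0 => butlast x | S _ => 0 end.

Lemma rooted_tree (c : code) (n : nat) : rooted (tree c n).
Proof.
intros x; unfold tree; destruct (run c n x); [apply rooted_butlast|lia].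
Qed.

Lemma run_pending_butlast (c : code) (n x : nat) :
  run c n x = 0 -> run c n (butlast x) = 0.
Proof.
destruct x as [|z]; [easy|].
change (butlast (S z)) with (nfst z); unfold run; intros H.
destruct (approx (read (nfst z)) (len (nfst z)) c n) as [|v] eqn:E; [easy|].
apply (approx_mono _ (read (S z)) _ (len (S z))) in E.
- congruence.
- apply read_succ_extends.
- rewrite len_succ; auto.
Qed.

(** The extensions of a halted string are halted and thus hang at the root, so
    that a branch, being infinite, meets no halted string.  It is therefore the
    sequence of initial segments of some [f], on one of which [c] halts. *)
Lemma halting_no_branch (c : code) (n : nat) :
  (forall f, exists y, eval f c n y) -> forall s, ~ branch (tree c n) s.
Proof.
intros Hc s Hs.
assert (Hpos : forall k, s (S k) <> 0)
  by (intros k E; assert (H := branch_ge _ s (S k) Hs); lia).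
assert (step : forall k, tree c n (s (S k)) = s k) by apply Hs.
assert (late : forall k, run c n (s (S (S k))) = 0).
{ intros k; specialize (step (S k)); unfold tree in step.
  destruct (run c n (s (S (S k)))); [easy|].
  now destruct (Hpos k). }
assert (run0 : forall k, run c n (s (S k)) = 0).
{ intros k; assert (H := run_pending_butlast _ _ _ (late k)).
  specialize (step (S k)); unfold tree in step; rewrite late in step.
  now rewrite step in H. }
set (f := fun k => nsnd (pred (s (S k)))).
assert (Hf : forall k, s k = prefix f k).
{ intros k; induction k as [|k IH]; [apply Hs|].
  assert (Hk := step k); unfold tree in Hk; rewrite run0 in Hk.
  simpl; rewrite <- IH, <- Hk; unfold f, butlast.
  rewrite npair_nfst_nsnd; specialize (Hpos k); lia. }
destruct (Hc f) as [y Hy].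
destruct (approx_complete f (fun m => read (prefix f m)) c n y) as [m Hm];
  trivial.
- apply read_prefix_mono.
- intros k; exists (S k); apply read_prefix; lia.
- apply (approx_mono _ (read (prefix f (S m))) _ (S m)) in Hm;
    [|apply read_prefix_mono; lia|lia].
  specialize (run0 m); unfold run in run0.
  rewrite Hf, len_prefix in run0; congruence.
Qed.

Lemma diverging_branch (c : code) (n : nat) (f : nat -> nat) :
  ~ (exists y, eval f c n y) -> branch (tree c n) (prefix f).
Proof.
intros Hf; split; [easy|]; intros k; split.
- unfold tree; destruct (run c n (prefix f (S k))) as [|y] eqn:E.
  + apply nfst_npair.
  + destruct Hf; exists y.
    exact (approx_sound _ _ _ _ _ _ (read_prefix_sound f (S k)) E).
- simpl; destruct (npair_bound (prefix f k) (f k)); lia.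
Qed.

(** The atom off the branch of [f] is a one-entry string whose entry differs
    from [f 0]. *)
Lemma singleton_off_prefix (f : nat -> nat) (k : nat) :
  S (npair 0 (S (f 0))) <> prefix f k.
Proof.
destruct k as [|k]; [easy|]; simpl; intros H; injection H as H.
assert (H1 := f_equal nfst H); assert (H2 := f_equal nsnd H).
rewrite !nfst_npair in H1; rewrite !nsnd_npair in H2.
destruct k as [|k]; [lia|easy].
Qed.

Lemma tree_singleton (c : code) (n v : nat) : tree c n (S (npair 0 v)) = 0.
Proof.
unfold tree; destruct (run _ _ _); [apply nfst_npair|easy].
Qed.

Lemma algebraic_tree_iff (c : code) (n : nat) :
  (forall f, exists y, eval f c n y) <-> algebraic (tree_le (tree c n)).
Proof.
split; intros H.
- apply no_branch_algebraic; [apply rooted_tree|].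
  now apply halting_no_branch.
- intros f; apply NNPP; intros Hf.
  apply diverging_branch in Hf; revert H.
  apply (branch_not_algebraic _ (prefix f) (S (npair 0 (S (f 0)))));
    [apply rooted_tree|exact Hf|apply tree_singleton|].
  apply singleton_off_prefix.
Qed.

(** * Computability of the lattice *)

Lemma computable_butlast (g : nat -> nat) :
  computable g -> computable (fun x => butlast (g x)).
Proof. unfold butlast; computability. Qed.

Lemma computable_iter_butlast (n g : nat -> nat) :
  computable n -> computable g ->
  computable (fun x => Nat.iter (n x) butlast (g x)).
Proof.
apply (computable_iter (fun _ => butlast) (fun _ => 0));
  auto 20 using computable_butlast with computable.
Qed.
#[local] Hint Resolve computable_butlast computable_iter_butlast : computable.

Lemma computable_len : computable len.
Proof.
apply (computable_rec (fun _ => 0) (fun x => x) (fun x i r =>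
  match Nat.iter i butlast x with 0 => r | S _ => S r end));
  computability.
apply (computable_case _ (fun w => nsnd (nsnd w))
  (fun w _ => S (nsnd (nsnd w)))); computability.
Qed.

Lemma computable_read : computable2 read.
Proof.
unfold computable2, read.
apply (computable_case _ (fun _ => 0) (fun w d =>
  S (nsnd (pred (Nat.iter d butlast (nfst w))))));
  computability.
apply computable_sub; [apply (computable_comp len)|];
  auto 20 using computable_len with computable.
Qed.

Lemma computable_tree (c : code) : computable2 (tree c).
Proof.
apply (computable_case _ (fun w => butlast (nsnd w)) (fun _ _ => 0));
  computability.
apply (computable2_app (fun x n => approx (read x) (len x) c n) nsnd nfst);
  computability.
apply computable_approx; [apply computable_read|apply computable_len].
Qed.

(** The ancestors of [y] are found within [y] steps; equality is tested by the
    vanishing of both truncated differences. *)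
Definition ancestor_char (p : nat -> nat) (x y : nat) : nat :=
  nat_rect (fun _ => nat) 0
    (fun k r =>
       match (Nat.iter k p y - x) + (x - Nat.iter k p y) with
       | 0 => 1
       | S _ => r
       end)
    (S y).

Definition tree_le_char (p : nat -> nat) (a b : nat) : nat :=
  match b with
  | 0 => 1
  | S y => match a with 0 => 0 | S x => ancestor_char p x y end
  end.

Lemma ancestor_char_spec (p : nat -> nat) (x y : nat) :
  rooted p ->
  (ancestor p x y -> ancestor_char p x y = 1) /\
  (~ ancestor p x y -> ancestor_char p x y = 0).
Proof.
intros Hp; unfold ancestor_char.
assert (H : forall n,
  let r := nat_rect (fun _ => nat) 0 (fun k r =>
    match (Nat.iter k p y - x) + (x - Nat.iter k p y) with
    | 0 => 1
    | S _ => r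
    end) n in
  (r = 1 /\ exists k, Nat.iter k p y = x) \/
  (r = 0 /\ forall k, k < n -> Nat.iter k p y <> x)).
{ induction n as [|n IH]; simpl; [right; split; lia|].
  destruct (Nat.iter n p y - x + (x - Nat.iter n p y)) eqn:E.
  - left; split; [easy|]; exists n; lia.
  - destruct IH as [IH|[-> IH]]; [now left|right].
    split; [easy|]; intros k Hk.
    destruct (Nat.eq_dec k n) as [->|]; [lia|apply IH; lia]. }
destruct (H (S y)) as [[-> Hk]|[-> Hk]]; split; intros Ha; try easy.
exfalso; destruct Ha as [k Ha].
assert (Hky := iter_rooted p k y Hp); assert (Hy := iter_rooted p y y Hp).
destruct (Nat.le_gt_cases k y); [apply (Hk k); [lia|easy]|].
apply (Hk y); lia.
Qed.

Lemma tree_le_char_spec (p : nat -> nat) (a b : nat) :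
  rooted p ->
  (tree_le p a b -> tree_le_char p a b = 1) /\
  (~ tree_le p a b -> tree_le_char p a b = 0).
Proof.
intros Hp; destruct b as [|y], a as [|x]; simpl; try tauto.
now apply ancestor_char_spec.
Qed.

Lemma computable_tree_le_char (c : code) :
  computable3 (fun n => tree_le_char (tree c n)).
Proof.
apply (computable_case _ (fun _ => 1) (fun w y =>
  match nfst (nsnd w) with
  | 0 => 0
  | S x => ancestor_char (tree c (nfst w)) x y
  end)); computability.
apply (computable_case _ (fun _ => 0) (fun w x =>
  ancestor_char (tree c (nfst (nfst w))) x (nsnd w))); computability.
apply (computable_rec (fun _ => 0) (fun w => S (nsnd (nfst w))) (fun w k r =>
  match (Nat.iter k (tree c (nfst (nfst (nfst w)))) (nsnd (nfst w)) - nsnd w) +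
        (nsnd w - Nat.iter k (tree c (nfst (nfst (nfst w)))) (nsnd (nfst w)))
  with 0 => 1 | S _ => r end)); computability.
apply (computable_case _ (fun _ => 1) (fun w _ => nsnd (nsnd w)));
  computability.
assert (H : computable (fun w => Nat.iter (nfst (nsnd w))
  (tree c (nfst (nfst (nfst (nfst w))))) (nsnd (nfst (nfst w))))).
{ apply (computable_iter (tree c) (fun w => nfst (nfst (nfst (nfst w)))));
    auto 20 using computable_tree with computable. }
computability.
Qed.

(** * The reduction *)

Lemma is_char_index_functional (e : nat) (le le' : relation nat) :
  is_char_index e le -> is_char_index e le' -> le = le'.
Proof.
intros H H'; apply functional_extensionality; intros x.
apply functional_extensionality; intros y; apply propositional_extensionality.
destruct (H x y) as [H1 H0], (H' x y) as [H1' H0'].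
assert (D : ~ (phi e (npair x y) 1 /\ phi e (npair x y) 0)).
{ intros [D1 D0]; discriminate (eval_functional _ _ _ _ _ D1 D0). }
split; intros Hxy; apply NNPP; tauto.
Qed.

Theorem proposition2p14 : Pi11_hard algebraic_lattice_indices.
Proof.
intros C [e He]; set (c := decode e).
destruct (smn (fun n w => tree_le_char (tree c n) (nfst w) (nsnd w))
  (computable_tree_le_char c)) as (g & Hg & Hgn).
assert (Hchar : forall n, is_char_index (g n) (tree_le (tree c n))).
{ intros n x y; specialize (Hgn n (npair x y)).
  rewrite nfst_npair, nsnd_npair in Hgn.
  destruct (tree_le_char_spec _ x y (rooted_tree c n)) as [H1 H0].
  split; intros Hxy; [rewrite H1 in Hgn|rewrite H0 in Hgn]; trivial. }
exists g; split; [exact Hg|]; intros n; rewrite He.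
split; intros H.
- exists (tree_le (tree c n)); split; [|now apply algebraic_tree_iff].
  split; [apply Hchar|now apply tree_le_lattice, rooted_tree].
- destruct H as (le & [Hle _] & Halg).
  rewrite (is_char_index_functional _ _ _ Hle (Hchar n)) in Halg.
  exact (proj2 (algebraic_tree_iff c n) Halg).
Qed.
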